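(* Let $(L,\alpha_L)$ be a perfect Hom-Leibniz algebra over a field $\mathbb{K}$. Then the central extension $\psi_L:(L\ast L,\alpha_{L\ast L})\twoheadrightarrow(L,\alpha_L)$, $\psi_L(l\ast l')=[l,l']$, is the universal central extension of $(L,\alpha_L)$.
   Context: Vector spaces and linear maps are over a fixed field $\mathbb{K}$. A Hom-Leibniz algebra $(L,\alpha_L)$ is a vector space $L$ with a bilinear bracket $[-,-]$ and a linear map $\alpha_L:L\to L$ such that $[\alpha_L(x),[y,z]]=[[x,y],\alpha_L(z)]-[[x,z],\alpha_L(y)]$ and (multiplicativity, always assumed) $\alpha_L[x,y]=[\alpha_L(x),\alpha_L(y)]$ for all $x,y,z$. Homomorphisms are linear maps preserving brackets and commuting with the $\alpha$'s. $(L,\alpha_L)$ is perfect if $L=[L,L]$ (the span of all brackets). The center is $Z(L)=\{x\in L\mid [x,y]=0=[y,x]\ \forall y\in L\}$. A central extension of $(L,\alpha_L)$ is a surjective homomorphism of Hom-Leibniz algebras $\pi:(K,\alpha_K)\twoheadrightarrow(L,\alpha_L)$ with $\operatorname{Ker}(\pi)\subseteq Z(K)$. It is a universal central extension if for every central extension $\pi':(K',\alpha_{K'})\twoheadrightarrow(L,\alpha_L)$ there is one and only one homomorphism $h:(K,\alpha_K)\to(K',\alpha_{K'})$ with $\pi'\circ h=\pi$. Non-abelian tensor product. For Hom-Leibniz algebras $(M,\alpha_M)$, $(N,\alpha_N)$ with (compatible) mutual actions $m^n,{}^nm\in M$ and ${}^mn,n^m\in N$, $M\ast N$ is the vector space spanned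 by all symbols $m\ast n$ and $n\ast m$ ($m\in M$, $n\in N$; the two kinds of symbols are formally distinct, even if $M=N$), bilinear in both arguments for each kind (so $M\ast N$ is a quotient of $(M\otimes N)\oplus(N\otimes M)$), subject to, for all $m,m'\in M$, $n,n'\in N$: $\alpha_M(m)\ast[n,n']=m^n\ast\alpha_N(n')-m^{n'}\ast\alpha_N(n)$; $\alpha_N(n)\ast[m,m']=n^m\ast\alpha_M(m')-n^{m'}\ast\alpha_M(m)$; $[m,m']\ast\alpha_N(n)={}^mn\ast\alpha_M(m')-\alpha_M(m)\ast n^{m'}$; $[n,n']\ast\alpha_M(m)={}^nm\ast\alpha_N(n')-\alpha_N(n)\ast m^{n'}$; $\alpha_M(m)\ast{}^{m'}n=-\alpha_M(m)\ast n^{m'}$; $\alpha_N(n)\ast{}^{n'}m=-\alpha_N(n)\ast m^{n'}$; $m^n\ast{}^{m'}n'={}^mn\ast m'^{\,n'}$; $m^n\ast n'^{\,m'}={}^mn\ast{}^{n'}m'$; ${}^nm\ast{}^{m'}n'=n^m\ast m'^{\,n'}$; ${}^nm\ast n'^{\,m'}=n^m\ast{}^{n'}m'$. It is a Hom-Leibniz algebra with $\alpha_{M\ast N}(m\ast n)=\alpha_M(m)\ast\alpha_N(n)$, $\alpha_{M\ast N}(n\ast m)=\alpha_N(n)\ast\alpha_M(m)$ and bracket $[m\ast n,m'\ast n']=m^n\ast{}^{m'}n'$, $[m\ast n,n'\ast m']=m^n\ast n'^{\,m'}$, $[n\ast m,m'\ast n']={}^nm\ast{}^{m'}n'$, $[n\ast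 m,n'\ast m']={}^nm\ast n'^{\,m'}$. $L\ast L$ is the case $M=N=L$ with all action operations given by the bracket of $L$, i.e. ${}^xy=[x,y]$ and $x^y=[x,y]$. The formula $\psi_L(l\ast l')=[l,l']$ applies to generators of both kinds. *)

(* Defs.v *)
From HB Require Import structures.
From mathcomp Require Import all_boot all_algebra.
From mathcomp Require Import generic_quotient ring_quotient.
From mathcomp Require Import boolp.
From mathcomp Require Import freeg.

Set Implicit Arguments.
Unset Strict Implicit.
Unset Printing Implicit Defensive.

Import GRing.Theory.
Local Open Scope ring_scope.
Local Open Scope quotient_scope.

Section Span.
Variables (F : fieldType) (V : lmodType F) (S : V -> Prop).

Inductive in_span : V -> Prop :=
| in_span0 : in_span 0
| in_spanZD a s v : S s -> in_span v -> in_span (a *: s + v).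

Lemma in_spanD u v : in_span u -> in_span v -> in_span (u + v).
Proof.
elim=> [|a s w Ss _ IH] hv; first by rewrite add0r.
by rewrite -addrA; apply: in_spanZD => //; apply: IH.
Qed.

Lemma in_spanZ c v : in_span v -> in_span (c *: v).
Proof.
elim=> [|a s w Ss _ IH]; first by rewrite scaler0; apply: in_span0.
by rewrite scalerDr scalerA; apply: in_spanZD.
Qed.

Lemma in_span_gen s : S s -> in_span s.
Proof.
by move=> Ss; rewrite -[s]scale1r -[_ *: _]addr0; apply: in_spanZD => //;
  apply: in_span0.
Qed.

Definition spanned : {pred V} := fun v => `[< in_span v >].

Lemma spanned_submod : submod_closed spanned.
Proof.
split=> [|a u v]; first exact/asboolP/in_span0.
by move=> /asboolP hu /asboolP hv; apply/asboolP/in_spanD => //; apply: in_spanZ.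
Qed.

HB.instance Definition _ :=
  GRing.isSubmodClosed.Build F V spanned spanned_submod.

Definition span_quot := Quotient.quot spanned.

HB.instance Definition _ := GRing.Zmodule.on span_quot.

Definition span_pi (v : V) : span_quot := \pi_(Quotient.quot spanned) v.
Definition span_repr (x : span_quot) : V := repr (x : (Quotient.quot spanned)).

Lemma span_reprK x : span_pi (span_repr x) = x.
Proof. exact: reprK. Qed.

Lemma span_pi_eqP u v : (span_pi u = span_pi v) <-> in_span (u - v).
Proof.
split=> [/eqP|h].
  by rewrite /span_pi -Quotient.idealrBE => /asboolP.
by apply/eqP; rewrite /span_pi -Quotient.idealrBE; apply/asboolP.
Qed.

Lemma span_piD : {morph span_pi : u v / u + v}.
Proof. by move=> u v; rewrite /span_pi piE. Qed.

Definition span_quot_scale (a : F) (x : span_quot) : span_quot :=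
  span_pi (a *: span_repr x).

Lemma span_quot_scaleE a v : span_quot_scale a (span_pi v) = span_pi (a *: v).
Proof.
apply/span_pi_eqP; rewrite -scalerBr; apply: in_spanZ.
by apply/span_pi_eqP; rewrite span_reprK.
Qed.

Fact span_quot_scaleA a b x :
  span_quot_scale a (span_quot_scale b x) = span_quot_scale (a * b) x.
Proof. by rewrite -[x]span_reprK !span_quot_scaleE scalerA. Qed.

Fact span_quot_scale1 : left_id 1 span_quot_scale.
Proof. by move=> x; rewrite -[x]span_reprK span_quot_scaleE scale1r. Qed.

Fact span_quot_scaleDr : right_distributive span_quot_scale +%R.
Proof.
move=> a x y; rewrite -[x]span_reprK -[y]span_reprK.
by rewrite -span_piD !span_quot_scaleE scalerDr span_piD.
Qed.

Fact span_quot_scaleDl x : {morph span_quot_scale^~ x : a b / a + b}.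
Proof.
by move=> a b; rewrite -[x]span_reprK !span_quot_scaleE scalerDl span_piD.
Qed.

HB.instance Definition _ := GRing.Zmodule_isLmodule.Build F span_quot
  span_quot_scaleA span_quot_scale1 span_quot_scaleDr span_quot_scaleDl.

Lemma span_pi_linear : linear span_pi.
Proof. by move=> a u v; rewrite span_piD -span_quot_scaleE. Qed.

HB.instance Definition _ :=
  GRing.isLinear.Build F V span_quot *:%R span_pi span_pi_linear.

Lemma span_liftE (W : lmodType F) (f : {linear V -> W}) :
  (forall s, S s -> f s = 0) -> forall v, f (span_repr (span_pi v)) = f v.
Proof.
move=> f0 v; apply/eqP; rewrite -subr_eq0 -raddfB /=; apply/eqP.
have : in_span (span_repr (span_pi v) - v).
  by apply/span_pi_eqP; rewrite span_reprK.
elim=> [|a s w Ss _ IH]; first exact: raddf0.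
by rewrite linearP IH f0 // scaler0 addr0.
Qed.

End Span.

HB.mixin Record isHomLeibniz (F : fieldType) L of GRing.Lmodule F L := {
  bracket : L -> L -> L;
  twist : L -> L;
  bracket_linearl : forall z, linear (bracket^~ z);
  bracket_linearr : forall x, linear (bracket x);
  twist_linear : linear twist;
  hom_leibniz : forall x y z,
    bracket (twist x) (bracket y z) =
    bracket (bracket x y) (twist z) - bracket (bracket x z) (twist y);
  twist_bracket : forall x y,
    twist (bracket x y) = bracket (twist x) (twist y)
}.

#[short(type="homLeibnizType")]
HB.structure Definition HomLeibniz (F : fieldType) :=
  {L of isHomLeibniz F L & GRing.Lmodule F L}.

Notation "⟦ x , y ⟧" := (bracket x y) (at level 0, format "⟦ x ,  y ⟧").

HB.instance Definition _ (F : fieldType) (L : homLeibnizType F) :=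
  GRing.isLinear.Build F L L *:%R twist twist_linear.

Section HomLeibnizNotions.
Variable F : fieldType.
Implicit Types A L : homLeibnizType F.

Definition is_hom A L (f : A -> L) : Prop :=
  [/\ linear f,
      forall x y, f ⟦x, y⟧ = ⟦f x, f y⟧
    & forall x, f (twist x) = twist (f x)].

Definition perfect L : Prop :=
  forall x : L, in_span (fun z => exists a b, z = ⟦a, b⟧) x.

Definition in_center L (x : L) : Prop :=
  forall y, ⟦x, y⟧ = 0 /\ ⟦y, x⟧ = 0.

Definition central_extension A L (p : A -> L) : Prop :=
  [/\ is_hom p,
      forall y, exists x, p x = y
    & forall x, p x = 0 -> in_center x].

Definition universal_central_extension A L (p : A -> L) : Prop :=
  central_extension p /\
  forall (A' : homLeibnizType F) (p' : A' -> L), central_extension p' ->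
    exists! h : A -> A', is_hom h /\ (forall x, p' (h x) = p x).

End HomLeibnizNotions.

Section FreegLinear.
Variables (F : fieldType) (T : choiceType) (W : lmodType F) (f : T -> W).

Lemma fglift_linear : linear (fglift f : {freeg T / F} -> W).
Proof.
pose g : {additive {freeg T / F} -> W} :=
  HB.pack (fglift f) (GRing.isZmodMorphism.Build _ _ (fglift f)
    (lift_is_additive f)).
have gE D : g D = fglift f D by [].
move=> a D E; rewrite -!gE raddfD; congr (_ + _).
have -> : a *: D = \sum_(x <- dom D) << a * coeff x D *g x >> by [].
have -> : g D = \sum_(x <- dom D) coeff x D *: f x.
  by rewrite -[in LHS](freeg_sumE D) raddf_sum; apply: eq_bigr => x _;
    rewrite gE liftU.
rewrite raddf_sum scaler_sumr.
by apply: eq_bigr => x _; rewrite gE liftU scalerA.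
Qed.

HB.instance Definition _ := GRing.isLinear.Build F {freeg T / F} W *:%R
  (fglift f) fglift_linear.

End FreegLinear.

(* The vector space M * N depends on the mutual actions only through their
   four operations, so no action axiom is required here:
     lM n m = ^n m,  rM m n = m ^ n,  lN m n = ^m n,  rN n m = n ^ m. *)
Section TensorSpace.
Variables (F : fieldType) (M N : homLeibnizType F).
Variables (lM : N -> M -> M) (rM : M -> N -> M).
Variables (lN : M -> N -> N) (rN : N -> M -> N).

(* inl (m, n) is the symbol m * n and inr (n, m) is the symbol n * m; the
   two kinds of symbols stay distinct even when M = N. *)
Definition tensor_sym : Type := ((M * N) + (N * M))%type.
HB.instance Definition _ := Choice.on tensor_sym.

Definition tensor_free := {freeg tensor_sym / F}.
HB.instance Definition _ := GRing.Lmodule.on tensor_free.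

Definition symMN (m : M) (n : N) : tensor_free :=
  Freeg [:: (1, inl (m, n) : tensor_sym)].
Definition symNM (n : N) (m : M) : tensor_free :=
  Freeg [:: (1, inr (n, m) : tensor_sym)].

Local Notation "m '*>' n" := (symMN m n) (at level 40).
Local Notation "n '<*' m" := (symNM n m) (at level 40).
Local Notation α := twist.

Inductive tensor_rel : tensor_free -> tensor_free -> Prop :=
| tensor_linMNl a m m' n :
    tensor_rel ((a *: m + m') *> n) (a *: (m *> n) + m' *> n)
| tensor_linMNr a m n n' :
    tensor_rel (m *> (a *: n + n')) (a *: (m *> n) + m *> n')
| tensor_linNMl a n n' m :
    tensor_rel ((a *: n + n') <* m) (a *: (n <* m) + n' <* m)
| tensor_linNMr a n m m' :
    tensor_rel (n <* (a *: m + m')) (a *: (n <* m) + n <* m')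
| tensor_brackMN m n n' :
    tensor_rel (α m *> ⟦n, n'⟧) (rM m n *> α n' - rM m n' *> α n)
| tensor_brackNM n m m' :
    tensor_rel (α n <* ⟦m, m'⟧) (rN n m <* α m' - rN n m' <* α m)
| tensor_mixMN m m' n :
    tensor_rel (⟦m, m'⟧ *> α n) (lN m n <* α m' - α m *> rN n m')
| tensor_mixNM n n' m :
    tensor_rel (⟦n, n'⟧ <* α m) (lM n m *> α n' - α n <* rM m n')
| tensor_antiMN m m' n :
    tensor_rel (α m *> lN m' n) (- (α m *> rN n m'))
| tensor_antiNM n n' m :
    tensor_rel (α n <* lM n' m) (- (α n <* rM m n'))
| tensor_rl m n m' n' :
    tensor_rel (rM m n *> lN m' n') (lN m n <* rM m' n')
| tensor_rr m n m' n' :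
    tensor_rel (rM m n *> rN n' m') (lN m n <* lM n' m')
| tensor_ll m n m' n' :
    tensor_rel (lM n m *> lN m' n') (rN n m <* rM m' n')
| tensor_lr m n m' n' :
    tensor_rel (lM n m *> rN n' m') (rN n m <* lM n' m').

Definition tensor_relator (w : tensor_free) : Prop :=
  exists u v, tensor_rel u v /\ w = u - v.

Definition tensor := span_quot tensor_relator.
HB.instance Definition _ := GRing.Lmodule.on tensor.

Definition tensMN (m : M) (n : N) : tensor := span_pi tensor_relator (m *> n).
Definition tensNM (n : N) (m : M) : tensor := span_pi tensor_relator (n <* m).

Definition tensor_sym_fun (W : Type) (f : M -> N -> W) (g : N -> M -> W)
    (s : tensor_sym) : W :=
  match s with inl (m, n) => f m n | inr (n, m) => g n m end.

Definition tensor_free_lift (W : lmodType F) f g : tensor_free -> W :=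
  fglift (tensor_sym_fun f g).
HB.instance Definition _ W f g :=
  GRing.Linear.copy (@tensor_free_lift W f g) (fglift (tensor_sym_fun f g)).

(* The linear map sending m * n to f m n and n * m to g n m; it is meaningful
   when f and g respect the relations (see tensor_lift_spec). *)
Definition tensor_lift (W : lmodType F) (f : M -> N -> W) (g : N -> M -> W)
    (x : tensor) : W :=
  tensor_free_lift f g (span_repr x).

Section LiftTheory.
Variables (W : lmodType F) (f : M -> N -> W) (g : N -> M -> W).

Lemma tensor_free_liftMN m n : tensor_free_lift f g (m *> n) = f m n.
Proof. by rewrite /tensor_free_lift /symMN liftU scale1r. Qed.

Lemma tensor_free_liftNM n m : tensor_free_lift f g (n <* m) = g n m.
Proof. by rewrite /tensor_free_lift /symNM liftU scale1r. Qed.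

Definition tensor_free_liftE := (tensor_free_liftMN, tensor_free_liftNM).

Lemma tensor_lift_spec :
  (forall u v, tensor_rel u v ->
     tensor_free_lift f g u = tensor_free_lift f g v) ->
  [/\ linear (tensor_lift f g),
      forall m n, tensor_lift f g (tensMN m n) = f m n
    & forall n m, tensor_lift f g (tensNM n m) = g n m].
Proof.
move=> fg.
have piE v :
    tensor_lift f g (span_pi tensor_relator v) = tensor_free_lift f g v.
  apply: span_liftE => w [u [u' [/fg uu' ->]]].
  by rewrite raddfB /= uu' subrr.
split=> [a x y|m n|n m]; last 2 first.
- by rewrite piE tensor_free_liftE.
- by rewrite piE tensor_free_liftE.
rewrite -[x]span_reprK -[y]span_reprK -linearP !piE.
exact: linearP.
Qed.

End LiftTheory.

Lemma tensor_relE u v :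
  tensor_rel u v -> span_pi tensor_relator u = span_pi tensor_relator v.
Proof. by move=> uv; apply/span_pi_eqP/in_span_gen; exists u, v. Qed.

End TensorSpace.

(* L * L: all four action operations are the bracket of L. *)
Section TensorSquare.
Variables (F : fieldType) (L : homLeibnizType F).

Local Notation br := (@bracket F L).

Definition tensor_square := tensor br br br br.
HB.instance Definition _ := GRing.Lmodule.on tensor_square.

(* The two kinds of generators l * l'. *)
Definition tens1 (x y : L) : tensor_square := tensMN br br br br x y.
Definition tens2 (x y : L) : tensor_square := tensNM br br br br x y.

Definition psi : tensor_square -> L := @tensor_lift F L L br br br br L br br.

Definition tensor_twist : tensor_square -> tensor_square :=
  @tensor_lift F L L br br br br tensor_square
    (fun m n => tens1 (twist m) (twist n))
    (fun n m => tens2 (twist n) (twist m)).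

(* On generators of either kind this is the bracket of M * N for M = N = L
   (see tensor_bracket11 to tensor_bracket22 below). *)
Definition tensor_bracket (u v : tensor_square) : tensor_square :=
  tens1 (psi u) (psi v).

Lemma psi_spec :
  [/\ linear psi, forall x y, psi (tens1 x y) = ⟦x, y⟧
    & forall x y, psi (tens2 x y) = ⟦x, y⟧].
Proof.
apply: tensor_lift_spec => u v.
have key (x y z : L) : ⟦⟦x, y⟧, twist z⟧ =
    ⟦⟦x, z⟧, twist y⟧ - ⟦twist x, ⟦z, y⟧⟧.
  by rewrite hom_leibniz opprB addrC subrK.
have anti (x y z : L) : ⟦twist x, ⟦y, z⟧⟧ = - ⟦twist x, ⟦z, y⟧⟧.
  by rewrite !hom_leibniz opprB.
by case=> [a m m' n|a m n n'|a n n' m|a n m m'|m n n'|n m m'|m m' n|n n' m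
          |m m' n|n n' m|m n m' n'|m n m' n'|m n m' n'|m n m' n'];
  rewrite ?(raddfD, raddfB, raddfN) /= ?linearZ_LR /= !tensor_free_liftE;
  rewrite ?bracket_linearl ?bracket_linearr // -?hom_leibniz -?key -?anti.
Qed.

Lemma psi_linear : linear psi. Proof. by case: psi_spec. Qed.
Lemma psi1 x y : psi (tens1 x y) = ⟦x, y⟧. Proof. by case: psi_spec. Qed.
Lemma psi2 x y : psi (tens2 x y) = ⟦x, y⟧. Proof. by case: psi_spec. Qed.

HB.instance Definition _ :=
  GRing.isLinear.Build F tensor_square L *:%R psi psi_linear.

Lemma tensor_twist_spec :
  [/\ linear tensor_twist,
      forall x y, tensor_twist (tens1 x y) = tens1 (twist x) (twist y)
    & forall x y, tensor_twist (tens2 x y) = tens2 (twist x) (twist y)].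
Proof.
pose E := (@tensor_relE F L L br br br br).
apply: tensor_lift_spec => u v.
by case=> [a m m' n|a m n n'|a n n' m|a n m m'|m n n'|n m m'|m m' n|n n' m
          |m m' n|n n' m|m n m' n'|m n m' n'|m n m' n'|m n m' n'];
  rewrite ?(raddfD, raddfB, raddfN) /= ?linearZ_LR /= !tensor_free_liftE;
  rewrite ?twist_linear ?twist_bracket /tens1 /tens2 /tensMN /tensNM
    -?(linearZ_LR (span_pi _)) -?(raddfN (span_pi _)) -?(raddfB (span_pi _))
    -?(raddfD (span_pi _)); apply: E; constructor.
Qed.

Lemma tensor_twist_linear : linear tensor_twist.
Proof. by case: tensor_twist_spec. Qed.
Lemma tensor_twist1 x y :
  tensor_twist (tens1 x y) = tens1 (twist x) (twist y).
Proof. by case: tensor_twist_spec. Qed.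
Lemma tensor_twist2 x y :
  tensor_twist (tens2 x y) = tens2 (twist x) (twist y).
Proof. by case: tensor_twist_spec. Qed.

HB.instance Definition _ := GRing.isLinear.Build F tensor_square tensor_square
  *:%R tensor_twist tensor_twist_linear.

Lemma tens_ind (P : tensor_square -> Prop) :
  P 0 -> (forall a u v, P u -> P v -> P (a *: u + v)) ->
  (forall x y, P (tens1 x y)) -> (forall x y, P (tens2 x y)) ->
  forall u, P u.
Proof.
move=> P0 PD P1 P2 u; rewrite -[u]span_reprK -[span_repr u]freeg_sumE.
rewrite raddf_sum /=; elim: (dom _) => [|s r IH]; first by rewrite big_nil.
rewrite big_cons; move: (coeff s _) => c.
have -> : << c *g s >> = c *: << s >> :> tensor_free L L.
  apply/eqP/freeg_eqP => t.
  by rewrite coeffZ !coeffU mul1r.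
rewrite linearZ_LR /=; apply: PD => //; case: s => -[x y].
  exact: P1.
exact: P2.
Qed.

Lemma psi_twist u : psi (tensor_twist u) = twist (psi u).
Proof.
elim/tens_ind: u => [|a u v IHu IHv|x y|x y].
- by rewrite !raddf0.
- by rewrite !linearP /= IHu IHv.
- by rewrite tensor_twist1 !psi1 twist_bracket.
- by rewrite tensor_twist2 !psi2 twist_bracket.
Qed.

Lemma tens1_linearl y : linear (tens1^~ y).
Proof.
move=> a x x'; rewrite /tens1 /tensMN -linearP.
by apply: tensor_relE; constructor.
Qed.

Lemma tens1_linearr x : linear (tens1 x).
Proof.
move=> a y y'; rewrite /tens1 /tensMN -linearP.
by apply: tensor_relE; constructor.
Qed.

Fact tensor_bracket_linearl v : linear (tensor_bracket^~ v).
Proof. by move=> a u u'; rewrite /tensor_bracket linearP tens1_linearl. Qed.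

Fact tensor_bracket_linearr u : linear (tensor_bracket u).
Proof. by move=> a v v'; rewrite /tensor_bracket linearP tens1_linearr. Qed.

Fact tensor_hom_leibniz u v w :
  tensor_bracket (tensor_twist u) (tensor_bracket v w) =
  tensor_bracket (tensor_bracket u v) (tensor_twist w)
    - tensor_bracket (tensor_bracket u w) (tensor_twist v).
Proof.
rewrite /tensor_bracket !psi1 !psi_twist /tens1 /tensMN -linearB.
by apply: tensor_relE; constructor.
Qed.

Fact tensor_twist_bracket u v :
  tensor_twist (tensor_bracket u v)
    = tensor_bracket (tensor_twist u) (tensor_twist v).
Proof. by rewrite /tensor_bracket tensor_twist1 !psi_twist. Qed.

HB.instance Definition _ := isHomLeibniz.Build F tensor_square
  tensor_bracket_linearl tensor_bracket_linearr tensor_twist_linear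
  tensor_hom_leibniz tensor_twist_bracket.

Lemma tensor_bracket11 m n m' n' :
  ⟦tens1 m n, tens1 m' n'⟧ = tens1 ⟦m, n⟧ ⟦m', n'⟧.
Proof. by rewrite /bracket /= /tensor_bracket !psi1. Qed.
Lemma tensor_bracket12 m n m' n' :
  ⟦tens1 m n, tens2 n' m'⟧ = tens1 ⟦m, n⟧ ⟦n', m'⟧.
Proof. by rewrite /bracket /= /tensor_bracket psi1 psi2. Qed.
Lemma tensor_bracket21 m n m' n' :
  ⟦tens2 n m, tens1 m' n'⟧ = tens1 ⟦n, m⟧ ⟦m', n'⟧.
Proof. by rewrite /bracket /= /tensor_bracket psi1 psi2. Qed.
Lemma tensor_bracket22 m n m' n' :
  ⟦tens2 n m, tens2 n' m'⟧ = tens1 ⟦n, m⟧ ⟦n', m'⟧.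
Proof. by rewrite /bracket /= /tensor_bracket !psi2. Qed.

End TensorSquare.

Arguments psi {F} L _.

(* Main.v *)
Require Import Defs.
From mathcomp Require Import all_boot all_algebra.
From mathcomp Require Import boolp.

(** The kernel of a central extension [p : A -> L] is central, so the bracket
    of two elements of [A] depends only on their images in [L]
    ([central_bracket_eq]).  Hence the bracket of [A] descends to a pairing
    [lifted_bracket : L -> L -> A], the bracket of arbitrary preimages.  This
    pairing inherits bilinearity and the Hom-Leibniz identity from [A], and the
    relations of [L * L], read with all actions equal to the bracket, are
    consequences of just these two properties.  So it factors through a linear
    map [L * L -> A] ([lifted_bracket_tensor_lift]), which is a homomorphism
    over [L]; this gives existence in the universal property.

    Two homomorphisms [L * L -> A] over [L] differ by central elements, so they
    agree on all brackets by [central_bracket_eq] again.  Uniqueness follows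
    because [L * L] is itself perfect ([tensor_square_perfect]): as [L] is
    spanned by brackets, so is [L * L] by the symbols on pairs of brackets, and
    the symbols [[a, b] * [c, d]] of either kind are brackets in [L * L].

    Finally [psi] is a central extension because the bracket of [L * L] is
    [[u, v] = psi u * psi v], which vanishes as soon as [psi u] or [psi v]
    does; it is onto because [L] is spanned by brackets. *)

Set Implicit Arguments.
Unset Strict Implicit.
Unset Printing Implicit Defensive.

Import GRing.Theory.
Local Open Scope ring_scope.

(** * Brackets, linear maps and spans *)

Section BracketTheory.
Variables (K : fieldType) (L : homLeibnizType K).
Implicit Types x y : L.

Lemma bracketBl x x' y : ⟦x - x', y⟧ = ⟦x, y⟧ - ⟦x', y⟧.
Proof. by rewrite addrC -scaleN1r bracket_linearl scaleN1r addrC. Qed.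

Lemma bracketBr x y y' : ⟦x, y - y'⟧ = ⟦x, y⟧ - ⟦x, y'⟧.
Proof. by rewrite addrC -scaleN1r bracket_linearr scaleN1r addrC. Qed.

End BracketTheory.

Section LinearSpan.
Variables (K : fieldType) (V W : lmodType K) (S : V -> Prop).

Lemma linear0_of (f : V -> W) : linear f -> f 0 = 0.
Proof. by move=> f_lin; rewrite -(subrr 0) -scaleN1r addrC f_lin scaleN1r addNr. Qed.

Lemma linearB_of (f : V -> W) : linear f -> {morph f : u v / u - v}.
Proof. by move=> f_lin u v; rewrite addrC -scaleN1r f_lin scaleN1r addrC. Qed.

Lemma in_span_linear (f : V -> W) (T : W -> Prop) : linear f ->
  (forall s, S s -> in_span T (f s)) -> forall v, in_span S v -> in_span T (f v).
Proof.
move=> f_lin fS v; elim=> [|a s w /fS Tfs _ IH].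
  by rewrite linear0_of //; apply: in_span0.
by rewrite f_lin; apply: in_spanD IH; apply: in_spanZ.
Qed.

Lemma eq_linear_in_span (f g : V -> W) : linear f -> linear g ->
  (forall s, S s -> f s = g s) -> forall v, in_span S v -> f v = g v.
Proof.
move=> f_lin g_lin fg v; elim=> [|a s w /fg eq_s _ IH].
  by rewrite !linear0_of.
by rewrite f_lin g_lin eq_s IH.
Qed.

End LinearSpan.

(** * The bracket of a central extension as a pairing on the base *)

Section CentralExtension.
Variables (K : fieldType) (A L : homLeibnizType K) (p : A -> L).
Hypothesis p_central : central_extension p.

Let p_lin : linear p. Proof. by case: p_central => -[]. Qed.
Let p_bracket a b : p ⟦a, b⟧ = ⟦p a, p b⟧.
Proof. by case: p_central => -[]. Qed.
Let p_twist a : p (twist a) = twist (p a).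
Proof. by case: p_central => -[]. Qed.
Let p_surj x : exists a, p a = x. Proof. by case: p_central. Qed.

(** Changing one argument within its fibre changes it by an element of
    the kernel, which brackets to zero with everything. *)
Lemma central_bracket_eq a a' b b' :
  p a = p a' -> p b = p b' -> ⟦a, b⟧ = ⟦a', b'⟧.
Proof.
have central_sub (c c' : A) : p c = p c' -> in_center (c - c').
  case: p_central => _ _ ker_central cc'; apply: ker_central.
  by rewrite linearB_of // cc' subrr.
move=> /central_sub aa' /central_sub bb'; transitivity ⟦a', b⟧.
  by apply/eqP; rewrite -subr_eq0 -bracketBl (aa' b).1.
by apply/eqP; rewrite -subr_eq0 -bracketBr (bb' a').2.
Qed.

(** The preimages are chosen without any linearity; linearity of the pairing
    comes from its independence of the choice ([lifted_bracketE]). *)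
Definition lifted_bracket (x y : L) : A :=
  ⟦projT1 (cid (p_surj x)), projT1 (cid (p_surj y))⟧.

Lemma lifted_bracketE a b : lifted_bracket (p a) (p b) = ⟦a, b⟧.
Proof. by apply: central_bracket_eq; case: cid. Qed.

Lemma lifted_bracketK x y : p (lifted_bracket x y) = ⟦x, y⟧.
Proof. by case: (p_surj x) (p_surj y) => a <- [b <-]; rewrite lifted_bracketE. Qed.

Lemma lifted_bracket_linearl y : linear (lifted_bracket^~ y).
Proof.
move=> c x x'; case: (p_surj x) (p_surj x') (p_surj y) => a <- [a' <-] [b <-].
by rewrite -p_lin !lifted_bracketE bracket_linearl.
Qed.

Lemma lifted_bracket_linearr x : linear (lifted_bracket x).
Proof.
move=> c y y'; case: (p_surj x) (p_surj y) (p_surj y') => a <- [b <-] [b' <-].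
by rewrite -p_lin !lifted_bracketE bracket_linearr.
Qed.

Lemma lifted_hom_leibniz x y z :
  lifted_bracket (twist x) ⟦y, z⟧ =
  lifted_bracket ⟦x, y⟧ (twist z) - lifted_bracket ⟦x, z⟧ (twist y).
Proof.
case: (p_surj x) (p_surj y) (p_surj z) => a <- [b <-] [c <-].
by rewrite -!p_bracket -!p_twist !lifted_bracketE hom_leibniz.
Qed.

Lemma lifted_bracket_twist x y :
  lifted_bracket (twist x) (twist y) = twist (lifted_bracket x y).
Proof.
case: (p_surj x) (p_surj y) => a <- [b <-].
by rewrite -!p_twist !lifted_bracketE twist_bracket.
Qed.

Definition tensor_square_lift : tensor_square L -> A :=
  @tensor_lift K L L bracket bracket bracket bracket A
    lifted_bracket lifted_bracket.

(** Apart from bilinearity, each defining relation of [L * L] is the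
    Hom-Leibniz identity, a rearrangement of it, its antisymmetry in the last
    two arguments, or an identification of the two kinds of symbols, which
    have the same image. *)
Lemma lifted_bracket_tensor_lift :
  [/\ linear tensor_square_lift,
      forall x y, tensor_square_lift (tens1 x y) = lifted_bracket x y
    & forall x y, tensor_square_lift (tens2 x y) = lifted_bracket x y].
Proof.
apply: tensor_lift_spec => u v.
have leibniz_left x y z : lifted_bracket ⟦x, y⟧ (twist z) =
    lifted_bracket ⟦x, z⟧ (twist y) - lifted_bracket (twist x) ⟦z, y⟧.
  by rewrite lifted_hom_leibniz opprB addrC subrK.
have leibniz_anti x y z :
    lifted_bracket (twist x) ⟦y, z⟧ = - lifted_bracket (twist x) ⟦z, y⟧.
  by rewrite !lifted_hom_leibniz opprB.
by case=> [a m m' n|a m n n'|a n n' m|a n m m'|m n n'|n m m'|m m' n|n n' m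
          |m m' n|n n' m|m n m' n'|m n m' n'|m n m' n'|m n m' n'];
  rewrite ?(raddfD, raddfB, raddfN) /= ?linearZ_LR /= !tensor_free_liftE;
  rewrite ?lifted_bracket_linearl ?lifted_bracket_linearr //
    -?lifted_hom_leibniz -?leibniz_left -?leibniz_anti.
Qed.

Lemma tensor_square_liftK u : p (tensor_square_lift u) = psi L u.
Proof.
have [lift_lin lift1 lift2] := lifted_bracket_tensor_lift.
elim/tens_ind: u => [|a u v IHu IHv|x y|x y].
- by rewrite !linear0_of //; apply: psi_linear.
- by rewrite lift_lin p_lin IHu IHv psi_linear.
- by rewrite lift1 lifted_bracketK psi1.
- by rewrite lift2 lifted_bracketK psi2.
Qed.

Lemma tensor_square_lift_hom : is_hom tensor_square_lift.
Proof.
have [lift_lin lift1 lift2] := lifted_bracket_tensor_lift.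
split=> // [u v|u].
  by rewrite [LHS]lift1 -!tensor_square_liftK lifted_bracketE.
elim/tens_ind: u => [|a u v IHu IHv|x y|x y].
- by rewrite !(linear0_of lift_lin, raddf0).
- by rewrite twist_linear !lift_lin IHu IHv twist_linear.
- by rewrite [twist _]tensor_twist1 !lift1 lifted_bracket_twist.
- by rewrite [twist _]tensor_twist2 !lift2 lifted_bracket_twist.
Qed.

(** The brackets span [B], and on a bracket both maps are determined by their
    values modulo the central kernel of [p]. *)
Lemma eq_hom_perfect (B : homLeibnizType K) (h h' : B -> A) :
  perfect B -> is_hom h -> is_hom h' -> (forall u, p (h u) = p (h' u)) ->
  h =1 h'.
Proof.
move=> B_perfect [h_lin h_br _] [h'_lin h'_br _] hh' u.
apply: eq_linear_in_span h_lin h'_lin _ _ (B_perfect u) => _ [a [b ->]].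
by rewrite h_br h'_br; apply: central_bracket_eq.
Qed.

End CentralExtension.

(** * The tensor square of a perfect algebra *)

Section TensorSquareOfPerfect.
Variables (K : fieldType) (L : homLeibnizType K).
Hypothesis L_perfect : perfect L.

Lemma tens2_linearl (y : L) : linear (fun x => tens2 x y : tensor_square L).
Proof.
by move=> a x x'; rewrite /tens2 /tensNM -linearP; apply: tensor_relE; constructor.
Qed.

Lemma tens2_linearr (x : L) : linear (tens2 x : L -> tensor_square L).
Proof.
by move=> a y y'; rewrite /tens2 /tensNM -linearP; apply: tensor_relE; constructor.
Qed.

(** The relation identifying [m^n * ^m' n'] with [^m n * m'^n'] exchanges the
    two kinds of symbols as soon as both entries are brackets. *)
Lemma tens2_bracket (a b c d : L) : tens2 ⟦a, b⟧ ⟦c, d⟧ = tens1 ⟦a, b⟧ ⟦c, d⟧.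
Proof. by apply/esym/tensor_relE; constructor. Qed.

(** Perfectness of [L] is used in both arguments: every symbol is a combination
    of symbols [[a, b] * [c, d]], which are brackets of [a * b] and [c * d]. *)
Lemma tensor_square_perfect : perfect (tensor_square L).
Proof.
pose brackets (z : tensor_square L) := exists a b, z = ⟦a, b⟧.
have bilin (t : L -> L -> tensor_square L) :
    (forall y, linear (t^~ y)) -> (forall x, linear (t x)) ->
    (forall a b c d, brackets (t ⟦a, b⟧ ⟦c, d⟧)) ->
    forall x y, in_span brackets (t x y).
  move=> tl tr t_br x y.
  apply: in_span_linear (tl y) _ _ (L_perfect x) => _ [a [b ->]].
  apply: in_span_linear (tr _) _ _ (L_perfect y) => _ [c [d ->]].
  exact: in_span_gen.
have br1 (a b c d : L) : brackets (tens1 ⟦a, b⟧ ⟦c, d⟧).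
  by exists (tens1 a b), (tens1 c d); rewrite tensor_bracket11.
elim/tens_ind => [|a u v spu spv|x y|x y].
- exact: in_span0.
- by apply: in_spanD => //; apply: in_spanZ.
- by apply: bilin x y => // [y|x]; [apply: tens1_linearl|apply: tens1_linearr].
- apply: bilin x y => [y|x|a b c d].
  + exact: tens2_linearl.
  + exact: tens2_linearr.
  + by rewrite tens2_bracket; apply: br1.
Qed.

Lemma psi_surjective x : exists u, psi L u = x.
Proof.
elim: (L_perfect x) => [|a _ y [b [c ->]] _ [u <-]].
  by exists 0; rewrite raddf0.
by exists (a *: tens1 b c + u); rewrite psi_linear psi1.
Qed.

Lemma psi_central_extension : central_extension (psi L : tensor_square L -> L).
Proof.
split=> [||u psi_u v]; [|exact: psi_surjective|].
  split=> [|u v|u]; [exact: psi_linear|exact: psi1|exact: psi_twist].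
rewrite /bracket /= /tensor_bracket psi_u; split.
  exact: (linear0_of (tens1_linearl _)).
exact: (linear0_of (tens1_linearr _)).
Qed.

End TensorSquareOfPerfect.

Theorem theorem4p4 (K : fieldType) (L : homLeibnizType K) :
  perfect L -> universal_central_extension (psi L : tensor_square L -> L).
Proof.
move=> L_perfect; split; first exact: psi_central_extension.
move=> A p p_central; exists (tensor_square_lift p_central); split.
  split; [exact: tensor_square_lift_hom|exact: tensor_square_liftK].
move=> h [h_hom ph]; apply/funext.
apply: (eq_hom_perfect p_central) => //.
- exact: tensor_square_perfect.
- exact: tensor_square_lift_hom.
- by move=> u; rewrite tensor_square_liftK ph.
Qed.
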